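(* Let $L\subset\mathbb{R}^n$ be an $n$-dimensional lattice with structure matrix $A=(a_{ij})$, and let $a_i$, $1\le i\le n$, be the column vectors of $A$. Then every nonzero vector of $L$ defines a coincidence reflection of $L$ if and only if the ratios $$\frac{(a_j,a_i)}{(a_k,a_k)},\qquad 1\le i,j,k\le n,$$ are all rational.
   Context: $\mathbb{R}^n$ carries the standard inner product $(\cdot,\cdot)$ and canonical basis $(e_1,\dots,e_n)$. The $n$-dimensional lattice $L\subset\mathbb{R}^n$ with structure matrix $A$ (a non-singular real $n\times n$ matrix) is the lattice $L=\bigoplus_{i=1}^n\mathbb{Z}a_i$ with basis $(a_1,\dots,a_n)=(e_1,\dots,e_n)A$, i.e. the $a_i$ are the columns of $A$. Let $O(n)$ be the group of orthogonal transformations of $\mathbb{R}^n$. A coincidence isometry of $L$ is an element of $OC(L)=\{\mathcal{R}\in O(n): [L:L\cap\mathcal{R}L]<\infty\}$. For nonzero $v\in\mathbb{R}^n$, the reflection defined by $v$ is $\mathcal{R}_v(x)=x-\frac{2(x,v)}{(v,v)}v$; it is a coincidence reflection of $L$ if $\mathcal{R}_v\in OC(L)$. *)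

(* Defs.v *)
From mathcomp Require Import all_boot all_order all_algebra.
From mathcomp Require Import boolp classical_sets cardinality reals.

Set Implicit Arguments.
Unset Strict Implicit.
Unset Printing Implicit Defensive.

Import Order.TTheory GRing.Theory Num.Theory.

Local Open Scope classical_set_scope.
Local Open Scope ring_scope.

Section Lattice.
Context {R : realType} {n : nat}.
Implicit Types (x y v : 'cV[R]_n) (A : 'M[R]_n).

Definition dotp x y : R := \sum_(i < n) x i 0 * y i 0.

Definition lattice A : set 'cV[R]_n :=
  [set x | exists z : 'I_n -> int, x = \sum_(i < n) (z i)%:~R *: col i A].

Definition coset (H : set 'cV[R]_n) x : set 'cV[R]_n := [set x + h | h in H].

(* [G : H] < oo for an additive subgroup H of G: G/H is a finite set of cosets. *)
Definition finite_index (G H : set 'cV[R]_n) : Prop :=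
  finite_set [set coset H x | x in G].

Definition orthogonal_group : set ('cV[R]_n -> 'cV[R]_n) :=
  [set f | linear f /\ forall x y, dotp (f x) (f y) = dotp x y].

Definition coincidence_isometries (L : set 'cV[R]_n) :
    set ('cV[R]_n -> 'cV[R]_n) :=
  [set f | orthogonal_group f /\ finite_index L (L `&` f @` L)].

Definition reflection v x : 'cV[R]_n :=
  x - (2 * dotp x v / dotp v v) *: v.

Definition coincidence_reflection (L : set 'cV[R]_n) v : Prop :=
  v != 0 /\ coincidence_isometries L (reflection v).

End Lattice.

(* Main.v *)
Require Import Defs.
From mathcomp Require Import all_boot all_order all_algebra.
From mathcomp Require Import boolp classical_sets cardinality reals.
From mathcomp Require Import ring.

(** Write L for the lattice, R_v for the reflection defined by v in L, and H for
    the intersection of L and R_v L.  The proof goes through the condition that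
    (x, v) / (v, v) is rational for all x and all nonzero v in L.

    This condition is the same as the rationality of the ratios of the basis.
    If the ratios are rational, expand (x, v) and (v, v) on the basis after
    dividing both by one fixed (a_k, a_k) ([lattice_rational]).  Conversely, a
    ratio (a_j, a_i) / (a_k, a_k) is the projection ratio
    (a_j, a_i) / (a_i, a_i) times a ratio of two squared norms, and such a ratio
    is a quotient of two projection ratios, taken on each other when the vectors
    are not orthogonal, on their sum when they are ([rational_norm_ratio]).

    For a fixed v, the condition is the same as R_v being a coincidence
    reflection, because H has finite index in L exactly when each vector of L
    has a positive multiple in H, and x - R_v x is 2 (x, v) / (v, v) times v.
    If the ratios (a_i, v) / (v, v) are rational, a common denominator N of the
    coefficients 2 (a_i, v) / (v, v) gives R_v (N L) inside L; as R_v is an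
    involution, N L is contained in H, hence H has finite index
    ([rational_coincidence_reflection]).  Conversely, if m x lies in H, then
    R_v (m x) lies in L, and so does the multiple m x - R_v (m x) of v; a real
    multiple of a nonzero lattice vector that stays in the lattice is a rational
    multiple ([coincidence_reflection_rational]). *)

Import Order.TTheory GRing.Theory Num.Theory.

Local Open Scope classical_set_scope.
Local Open Scope ring_scope.

(** * Rational real numbers *)

Section Rational.
Context {R : realType}.
Implicit Types r s : R.

Lemma rational_ratr (q : rat) : rational (ratr q : R).
Proof. by exists q. Qed.

Lemma rational_int (z : int) : rational (z%:~R : R).
Proof. by exists z%:~R => //; rewrite ratr_int. Qed.

Lemma rational_nat (m : nat) : rational (m%:R : R).
Proof. by exists m%:R => //; rewrite ratr_nat. Qed.

Lemma rationalD r s : rational r -> rational s -> rational (r + s).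
Proof. by move=> [p _ <-] [q _ <-]; rewrite -rmorphD; apply: rational_ratr. Qed.

Lemma rationalM r s : rational r -> rational s -> rational (r * s).
Proof. by move=> [p _ <-] [q _ <-]; rewrite -rmorphM; apply: rational_ratr. Qed.

Lemma rationalV r : rational r -> rational r^-1.
Proof. by move=> [q _ <-]; rewrite -fmorphV; apply: rational_ratr. Qed.

Lemma rational_div r s : rational r -> rational s -> rational (r / s).
Proof. by move=> ratr_r ratr_s; apply/rationalM/rationalV. Qed.

Lemma rational_sum (I : finType) (F : I -> R) :
  (forall i, rational (F i)) -> rational (\sum_i F i).
Proof.
move=> ratF; elim/big_ind: _ => // [|r s]; first exact: (rational_nat 0).
exact: rationalD.
Qed.

Lemma common_denominator (I : finType) (q : I -> R) :
  (forall i, rational (q i)) ->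
  exists2 N : nat, (0 < N)%N & forall i, exists z : int, N%:R * q i = z%:~R.
Proof.
move=> /(_ _)/cid2-/all_sig2[p _ pE].
exists (\prod_i `|denq (p i)|)%N.
  by apply: prodn_gt0 => i; rewrite absz_gt0 denq_neq0.
move=> i; rewrite (bigD1 i) //=; set M := (\prod_(_ | _) _)%N.
exists (M%:Z * numq (p i)).
have denE : (`|denq (p i)|%N%:R : R) = ratr (denq (p i))%:~R.
  by rewrite ratr_int -[denq _ in RHS]gez0_abs // denq_ge0.
rewrite natrM -pE denE mulrAC -rmorphM mulrC /= [X in ratr X]mulrC.
by rewrite -numqE ratr_int intrM.
Qed.

End Rational.

(** * Inner product and reflections *)

Section InnerProduct.
Context {R : realType} {n : nat}.
Implicit Types (x y v w : 'cV[R]_n) (c : R).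

Lemma dotpC x y : dotp x y = dotp y x.
Proof. by apply: eq_bigr => i _; rewrite mulrC. Qed.

Lemma dotpDl x y w : dotp (x + y) w = dotp x w + dotp y w.
Proof. by rewrite -big_split; apply: eq_bigr => i _; rewrite mxE mulrDl. Qed.

Lemma dotpZl c x w : dotp (c *: x) w = c * dotp x w.
Proof. by rewrite mulr_sumr; apply: eq_bigr => i _; rewrite mxE mulrA. Qed.

Lemma dotp_suml (I : finType) (F : I -> 'cV[R]_n) w :
  dotp (\sum_i F i) w = \sum_i dotp (F i) w.
Proof.
apply: (big_morph (fun x => dotp x w)); first by move=> x y; apply: dotpDl.
by rewrite -(scale0r 0) dotpZl mul0r.
Qed.

Lemma dotpDr w x y : dotp w (x + y) = dotp w x + dotp w y.
Proof. by rewrite ![dotp w _]dotpC dotpDl. Qed.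

Lemma dotpZr c w x : dotp w (c *: x) = c * dotp w x.
Proof. by rewrite ![dotp w _]dotpC dotpZl. Qed.

Lemma dotp_ge0 v : 0 <= dotp v v.
Proof. by apply: sumr_ge0 => i _; rewrite -expr2 sqr_ge0. Qed.

Lemma dotp_eq0 v : (dotp v v == 0) = (v == 0).
Proof.
apply/idP/eqP => [|->]; last by rewrite -(scale0r 0) dotpZl mul0r.
rewrite psumr_eq0 => [/allP v0|i _]; last by rewrite -expr2 sqr_ge0.
apply/colP => i; rewrite mxE; apply/eqP.
by have := v0 i (mem_index_enum i); rewrite mulf_eq0 orbb.
Qed.

Lemma reflectionD v x y : reflection v (x + y) = reflection v x + reflection v y.
Proof.
rewrite /reflection dotpDl mulrDr mulrDl scalerDl opprD.
by rewrite addrACA.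
Qed.

Lemma reflectionZ v c x : reflection v (c *: x) = c *: reflection v x.
Proof.
by rewrite /reflection dotpZl scalerBr scalerA; congr (_ - _ *: _); ring.
Qed.

Lemma reflection0 v : reflection v 0 = 0.
Proof. by have := reflectionZ v 0 0; rewrite !scale0r. Qed.

Lemma reflection_orthogonal v : v != 0 -> orthogonal_group (reflection v).
Proof.
rewrite -dotp_eq0 => vv0; split=> [c x y|x y].
  by rewrite reflectionD reflectionZ.
rewrite /reflection -!scaleNr !(dotpDl, dotpDr, dotpZl, dotpZr) [dotp v y]dotpC.
by field.
Qed.

Lemma reflectionK v : v != 0 -> involutive (reflection v).
Proof.
rewrite -dotp_eq0 => vv0 x.
rewrite /reflection -!scaleNr dotpDl dotpZl -addrA -scalerDl.
rewrite -[RHS]addr0; congr (_ + _); apply/eqP; rewrite scaler_eq0; apply/orP.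
by left; apply/eqP; field.
Qed.

End InnerProduct.

(** * Lattices and their coincidence reflections *)

Section Lattice.
Context {R : realType} {n : nat}.
Variable A : 'M[R]_n.
Implicit Types (x y v w : 'cV[R]_n) (H : set 'cV[R]_n).
Local Notation L := (lattice A).

(** Integer column vectors carry the coordinates, so that lattice points can be
    handled by matrix algebra and recovered by inverting A. *)
Lemma latticeE x : L x <-> exists z : 'cV[int]_n, x = A *m map_mx intr z.
Proof.
have sumE (z : 'I_n -> int) :
    \sum_i (z i)%:~R *: col i A = A *m map_mx intr (\col_i z i).
  apply/colP => i; rewrite summxE !mxE; apply: eq_bigr => j _.
  by rewrite !mxE mulrC.
split=> [[z ->]|[z ->]]; first by exists (\col_i z i); rewrite sumE.
exists (fun i => z i 0); rewrite sumE; congr (_ *m map_mx _ _).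
by apply/colP => i; rewrite mxE.
Qed.

Lemma latticeD x y : L x -> L y -> L (x + y).
Proof.
rewrite !latticeE => -[z ->] [t ->]; exists (z + t).
by rewrite map_mxD mulmxDr.
Qed.

Lemma latticeZ (c : int) x : L x -> L (c%:~R *: x).
Proof.
rewrite !latticeE => -[z ->]; exists (c *: z).
by rewrite map_mxZ scalemxAr.
Qed.

Lemma latticeB x y : L x -> L y -> L (x - y).
Proof. by move=> Lx Ly; rewrite -scaleN1r; apply/latticeD/(latticeZ (-1)). Qed.

Lemma lattice0 : L 0.
Proof. by apply/latticeE; exists 0; rewrite map_mx0 mulmx0. Qed.

Lemma lattice_col i : L (col i A).
Proof.
apply/latticeE; exists (delta_mx i 0).
by rewrite map_delta_mx colE.
Qed.

Lemma col_unitmx_neq0 i : A \in unitmx -> col i A != 0.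
Proof.
move=> Aunit; apply/eqP; rewrite colE => /(congr1 (mulmx (invmx A))).
rewrite mulKmx // mulmx0 => /matrixP/(_ i 0); rewrite !mxE !eqxx => /eqP.
by rewrite oner_eq0.
Qed.

(** By the pigeonhole principle two multiples of x lie in the same coset; their
    difference lies in H. *)
Lemma finite_index_multiple H x :
  finite_index L H -> H 0 -> L x -> exists2 m : nat, (0 < m)%N & H (m%:R *: x).
Proof.
move=> finLH H0 Lx.
have LZ m : L (m%:R *: x) by apply: (latticeZ m).
(* Otherwise the multiples of x would give infinitely many cosets. *)
have [m1 [m2 [lt_m eq_coset]]] : exists m1 m2 : nat,
    (m1 < m2)%N /\ coset H (m1%:R *: x) = coset H (m2%:R *: x).
  apply: contrapT => distinct; apply: infinite_nat.
  pose F (m : nat) := coset H (m%:R *: x).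
  have -> : [set: nat] = F @^-1` [set coset H y | y in L].
    by apply/seteqP; split=> // m _ /=; exists (m%:R *: x).
  apply: finite_preimage finLH => m1 m2 _ _ eqF.
  case: (ltngtP m1 m2) => // lt_m; exfalso; apply: distinct.
    by exists m1, m2.
  by exists m2, m1.
exists (m2 - m1)%N; first by rewrite subn_gt0.
have : coset H (m2%:R *: x) (m2%:R *: x) by exists 0; rewrite ?addr0.
rewrite -eq_coset => -[h Hh hE].
by rewrite natrB ?(ltnW lt_m) // scalerBl -hE addrAC subrr add0r.
Qed.

(** The coset of a lattice point only depends on its coordinates modulo N, which
    take finitely many values. *)
Lemma multiple_finite_index H (N : nat) :
  (forall x y, H x -> H y -> H (x + y)) -> (0 < N)%N ->
  (forall x, L x -> H (N%:R *: x)) -> finite_index L H.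
Proof.
move=> HD N_gt0 NLH.
pose rep (r : 'cV['I_N]_n) : 'cV[R]_n := A *m map_mx (fun k : 'I_N => (k%:R : R)) r.
apply: (@sub_finite_set _ _ [set coset H (rep r) | r in [set: 'cV['I_N]_n]]).
  move=> _ [x /latticeE[z xE] <-].
  (* Reduce the coordinates of x modulo N: x is y plus N times a lattice point. *)
  have Nz0 : N%:Z != 0 by rewrite -lt0n.
  pose r i := `|(z i 0%R %% N)%Z|%N.
  have rN i : (r i < N)%N.
    by rewrite -ltz_nat gez0_abs ?modz_ge0 // ltz_mod.
  have rE i : (r i)%:R = ((z i 0%R %% N)%Z)%:~R :> R.
    by rewrite -[in RHS](gez0_abs (modz_ge0 _ Nz0)).
  exists (\col_i Ordinal (rN i)) => //.
  set y := rep _; pose q : 'cV[int]_n := \col_i (z i 0%R %/ N)%Z.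
  have xyE : x = y + N%:R *: (A *m map_mx intr q).
    rewrite xE scalemxAr -mulmxDr; congr (_ *m _); apply/colP => i.
    by rewrite !mxE /= rE {1}(divz_eq (z i 0) N) rmorphD rmorphM addrC mulrC.
  have Lq (p : 'cV[int]_n) : L (A *m map_mx intr p) by apply/latticeE; exists p.
  apply/seteqP; split=> _ [h Hh <-].
    exists (h - N%:R *: (A *m map_mx intr q)); last by rewrite xyE addrACA subrr addr0.
    by apply: HD => //; rewrite -scalerN -mulmxN -map_mxN; apply: NLH.
  exists (h + N%:R *: (A *m map_mx intr q)); last by rewrite xyE addrA addrAC.
  by apply: HD => //; apply: NLH.
exact/finite_image/finite_finset.
Qed.

(** Comparing a nonzero coordinate of v with that of its multiple expresses c as a
    quotient of integers. *)
Lemma rational_scaler c v :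
  A \in unitmx -> v != 0 -> L v -> L (c *: v) -> rational c.
Proof.
move=> Aunit v0 /latticeE[z vE] /latticeE[t cvE].
have tE : map_mx intr t = c *: map_mx intr z :> 'cV[R]_n.
  by apply: (can_inj (mulKmx Aunit)); rewrite -cvE vE scalemxAr.
have [i zi0] : exists i, z i 0 != 0.
  apply: contrapT => z0; move/eqP: v0; apply; rewrite vE.
  have -> : z = 0; last by rewrite map_mx0 mulmx0.
  apply/colP => i; rewrite mxE; apply/eqP/negPn/negP => zi0.
  by apply: z0; exists i.
have -> : c = (t i 0)%:~R / (z i 0)%:~R.
  have /colP/(_ i) := tE; rewrite !mxE => ->.
  by rewrite mulfK // intr_eq0.
by apply: rational_div; apply: rational_int.
Qed.

(** Some m x with m > 0 lies in both L and R_v L, so L contains the difference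
    between m x and its mirror image, which is a multiple of v by a coefficient
    proportional to (x, v) / (v, v). *)
Lemma coincidence_reflection_rational v x :
  A \in unitmx -> L v -> L x -> coincidence_reflection L v ->
  rational (dotp x v / dotp v v).
Proof.
move=> Aunit Lv Lx [v0 [_ finLH]].
have [||m m_gt0 [Lmx [l Ll lE]]] := finite_index_multiple _ x finLH => //.
  split; first exact: lattice0.
  by exists 0; [exact: lattice0 | exact: reflection0].
have mE : m%:R != 0 :> R by rewrite pnatr_eq0 -lt0n.
pose c : R := 2 * dotp (m%:R *: x) v / dotp v v.
have Lcv : L (c *: v).
  (* The lattice point l is R_v (m x), since R_v is an involution. *)
  have -> : c *: v = m%:R *: x - l.
    by rewrite -[l](reflectionK v v0) lE /reflection subKr.
  exact: latticeB.
have -> : dotp x v / dotp v v = c / (2 * m%:R).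
  rewrite /c dotpZl; field.
  by rewrite mE dotp_eq0 v0.
apply: rational_div; first exact: rational_scaler Lcv.
by apply: rationalM; apply: rational_nat.
Qed.

(** If (y, w) is nonzero, divide the projection ratios of y on w and of w on y.
    If it is zero these ratios carry no information, but (y, s) = (y, y) and
    (w, s) = (w, w) for the lattice vector s = y + w. *)
Lemma rational_norm_ratio y w :
  (forall v x, L v -> v != 0 -> L x -> rational (dotp x v / dotp v v)) ->
  L y -> L w -> y != 0 -> w != 0 -> rational (dotp y y / dotp w w).
Proof.
move=> rat_proj Ly Lw y0 w0.
have yy0 : dotp y y != 0 by rewrite dotp_eq0.
have ww0 : dotp w w != 0 by rewrite dotp_eq0.
have [yw0|yw0] := eqVneq (dotp y w) 0; last first.
  have -> : dotp y y / dotp w w = dotp y w / dotp w w / (dotp w y / dotp y y).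
    by rewrite [dotp w y]dotpC; field; rewrite yw0 yy0 ww0.
  by apply: rational_div; apply: rat_proj.
have sE : dotp (y + w) (y + w) = dotp y y + dotp w w.
  by rewrite dotpDl !dotpDr [dotp w y]dotpC yw0 addr0 add0r.
have s0 : dotp y y + dotp w w != 0.
  by rewrite paddr_eq0 ?dotp_ge0 // negb_and yy0.
have yw_neq0 : y + w != 0 by rewrite -dotp_eq0 sE.
have Lyw : L (y + w) by exact: latticeD.
have -> : dotp y y / dotp w w =
    dotp y (y + w) / dotp (y + w) (y + w) / (dotp w (y + w) / dotp (y + w) (y + w)).
  by rewrite sE !dotpDr [dotp w y]dotpC yw0 addr0 add0r; field; rewrite ww0 s0.
by apply: rational_div; apply: rat_proj.
Qed.

(** Up to the common factor (a_k, a_k), all inner products of lattice vectors are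
    rational; the factor cancels in the quotient. *)
Lemma lattice_rational x v :
  (forall i j k : 'I_n,
     rational (dotp (col j A) (col i A) / dotp (col k A) (col k A))) ->
  A \in unitmx -> L x -> L v -> v != 0 -> rational (dotp x v / dotp v v).
Proof.
move=> ratA Aunit Lx Lv v0.
(* A basis vector exists because v is nonzero. *)
have [k _] : exists k : 'I_n, v k 0 != 0.
  by apply/existsP; apply: contraNT v0 => /existsPn v0; apply/eqP/colP => i;
     rewrite mxE; apply/eqP/negPn/v0.
have col0 : dotp (col k A) (col k A) != 0 by rewrite dotp_eq0 col_unitmx_neq0.
have vv0 : dotp v v != 0 by rewrite dotp_eq0.
have rat_k y w : L y -> L w -> rational (dotp y w / dotp (col k A) (col k A)).
  move=> [z ->] [t ->]; rewrite dotp_suml mulr_suml; apply: rational_sum => j.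
  rewrite dotpC dotp_suml mulr_suml; apply: rational_sum => i.
  rewrite dotpZl dotpZr dotpC -!mulrA.
  by do 2!(apply: rationalM; first exact: rational_int).
have -> : dotp x v / dotp v v =
    dotp x v / dotp (col k A) (col k A) / (dotp v v / dotp (col k A) (col k A)).
  by field; rewrite vv0 col0.
by apply: rational_div; apply: rat_k.
Qed.

(** A common denominator N of the coefficients 2 (a_i, v) / (v, v) satisfies
    R_v (N L) inside L; applying the involution R_v shows that N L is contained in
    R_v L. *)
Lemma rational_coincidence_reflection v :
  (forall x, L x -> rational (dotp x v / dotp v v)) ->
  L v -> v != 0 -> coincidence_reflection L v.
Proof.
move=> rat_proj Lv v0; split=> //; split; first exact: reflection_orthogonal.
have [|N N_gt0 NP] :=
    @common_denominator R 'I_n (fun i => 2 * (dotp (col i A) v / dotp v v)).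
  move=> i; apply: rationalM; first exact: rational_nat.
  exact/rat_proj/lattice_col.
have NLL x : L x -> L (reflection v (N%:R *: x)).
  move=> Lx; rewrite /reflection; apply: latticeB; first exact: (latticeZ N).
  have [z ->] := Lx; have /choice[t tE] := NP.
  have -> : 2 * dotp (N%:R *: \sum_i (z i)%:~R *: col i A) v / dotp v v =
      (\sum_i z i * t i)%:~R.
    rewrite dotpZl dotp_suml !mulr_sumr mulr_suml rmorph_sum.
    by apply: eq_bigr => i _; rewrite rmorphM /= -tE dotpZl; ring.
  exact: latticeZ.
apply: (@multiple_finite_index _ N) => // [x y|x Lx].
  move=> [Lx [x' Lx' xE]] [Ly [y' Ly' yE]]; split; first exact: latticeD.
  by exists (x' + y'); [exact: latticeD | rewrite reflectionD xE yE].
split; first exact: (latticeZ N).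
by exists (reflection v (N%:R *: x)); [exact: NLL | exact: (reflectionK v v0)].
Qed.

End Lattice.

Theorem theorem3p2 (R : realType) (n : nat) (A : 'M[R]_n)
    (A_nonsingular : A \in unitmx) :
  (forall v : 'cV[R]_n, lattice A v -> v != 0 ->
     coincidence_reflection (lattice A) v)
  <->
  (forall i j k : 'I_n,
     rational (dotp (col j A) (col i A) / dotp (col k A) (col k A))).
Proof.
have col_neq0 i : col i A != 0 by exact: col_unitmx_neq0.
split=> [coinc i j k|ratA v Lv v0]; last first.
  apply: rational_coincidence_reflection => // x Lx.
  exact: lattice_rational.
have rat_proj v x : lattice A v -> v != 0 -> lattice A x ->
    rational (dotp x v / dotp v v).
  by move=> Lv v0 Lx; apply: (coincidence_reflection_rational A) => //; apply: coinc.
have -> : dotp (col j A) (col i A) / dotp (col k A) (col k A) =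
    (dotp (col j A) (col i A) / dotp (col i A) (col i A)) *
    (dotp (col i A) (col i A) / dotp (col k A) (col k A)).
  by rewrite mulrA divfK // dotp_eq0.
apply: rationalM; first by apply: rat_proj; rewrite ?col_neq0 //; apply: lattice_col.
by apply: (rational_norm_ratio A) => //; rewrite ?col_neq0 //; apply: lattice_col.
Qed.
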